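(* For each $k\ge 1$, let $$R_{k-1}(q)=\begin{cases}P_{k-1}(q), & \text{if } k\not\equiv 2 \pmod 3,\\ P_{k-1}(q)/(q^2+q+1), & \text{if } k\equiv 2\pmod 3.\end{cases}$$ Then $R_{k-1}(q)$ is a polynomial in $\mathbb{Z}[q]$ that is irreducible over $\mathbb{Q}$.
   Context: For $k\ge 1$, define $P_{k-1}(q)=1+\sum_{l=1}^{k} q^{4l-4}(q^4-q^3-q^2-q)=q^{4k}-q^{4k-1}-q^{4k-2}-q^{4k-3}+q^{4k-4}-\cdots-q^5+q^4-q^3-q^2-q+1$. Equivalently $P_0=q^4-q^3-q^2-q+1$, $P_1=q^8-q^7-q^6-q^5+q^4-q^3-q^2-q+1$, and $P_k=(q^4+1)P_{k-1}-q^4P_{k-2}$. One has $P_k(q)=q^{2k+2}\,q_k(q+q^{-1}+2)$, where $q_0(x)=x^2-5x+3$, $q_1(x)=(x^3-8x^2+17x-5)(x-1)$, $q_k=(x^2-4x+2)q_{k-1}-q_{k-2}$. *)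

(* Defs.v *)
From HB Require Import structures.
From mathcomp Require Import all_boot all_order all_algebra.
Set Implicit Arguments. Unset Strict Implicit. Unset Printing Implicit Defensive.
Import Order.TTheory GRing.Theory Num.Theory.
Local Open Scope ring_scope.

Definition Pk (n : nat) : {poly int} :=
  1 + \sum_(l < n.+1) 'X^(4 * l) * ('X^4 - 'X^3 - 'X^2 - 'X).

(* Main.v *)
Require Import Defs.
From HB Require Import structures.
From mathcomp Require Import all_boot all_order all_algebra.
From mathcomp Require Import all_field ring zify.
Import Order.TTheory GRing.Theory Num.Theory.
Local Open Scope ring_scope.

(** Let P = P_{k-1}, N = 4k + 1 and A = X^3 - X^2 - X - 1, with reversal
    A* = 1 - X - X^2 - X^3. Then (X^4 - 1) P = X^N A - A*, and
    (X - 1) P = 1 - X^N + 2 G with G in Z[X] ([Pk_half] below).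
    - On the roots of P, the Schur-Cohn kernel
      ((aw)^N A(a) A(w) - A*(a) A*(w)) / (aw - 1), with w = conj b, vanishes as
      soon as aw <> 1, while it is a sum of Hermitian squares minus a single
      one. Hence P has at most one root outside the closed unit disk.
    - P has no double root: otherwise N / 2 would be an algebraic integer.
    - Let f be a nonconstant factor of P over Q without root outside the
      closed disk. The product of its roots is a nonzero integer, so they all
      have modulus 1. For such a root z, z^N = 1 + 2 G(z) gives |G(z)| <= 1; as
      the product of the G(z) is an integer, some root has G(z) = 0 or
      |G(z)| = 1, i.e. z^N = 1 or z^N = -1. With z^N A(z) = A*(z) this
      leaves only the primitive cube roots of unity, which are roots of P
      exactly when k = 2 mod 3.
    Two nonconstant factors of R would then share their root outside the disk,
    or one of them would share a root with X^2 + X + 1: a double root of P. *)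

(** * Closed forms of P *)

Definition salem_num (R : pzRingType) (a : R) : R := a ^+ 3 - a ^+ 2 - a - 1.
Definition salem_rev (R : pzRingType) (a : R) : R := 1 - a - a ^+ 2 - a ^+ 3.

(** P has coefficient +1 at the exponents [4 * l] and -1 elsewhere: it is twice this sum minus 1 + X
    + ... + X^(N-1), whence the factor X - 1. *)
Definition Pk_half (n : nat) : {poly int} := ('X - 1) * \sum_(l < n.+2) 'X^(4 * l).

Lemma mulXsub1_Pk n :
  ('X - 1) * Pk n = 1 - 'X^(4 * n + 5) + Pk_half n *+ 2.
Proof.
rewrite /Pk /Pk_half; elim: n => [|n IH].
  by rewrite !big_ord_recr !big_ord0 /= !(muln0, muln1, add0n, expr0); ring.
rewrite big_ord_recr addrA mulrDr IH [in RHS]big_ord_recr /=.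
rewrite !mulnS !exprD; ring.
Qed.

Lemma mulX4sub1_Pk n :
  ('X^4 - 1) * Pk n =
  'X^(4 * n + 5) * ('X^3 - 'X^2 - 'X - 1) - (1 - 'X - 'X^2 - 'X^3).
Proof.
rewrite /Pk; elim: n => [|n IH].
  by rewrite big_ord_recr big_ord0 /= muln0 add0n expr0; ring.
rewrite big_ord_recr addrA mulrDr IH /=.
rewrite !mulnS !exprD; ring.
Qed.

Lemma map_mulXsub1_Pk (n : nat) :
  ('X - 1) * map_poly intr (Pk n) =
  1 - 'X^(4 * n + 5) + map_poly intr (Pk_half n) *+ 2 :> {poly algC}.
Proof.
have := congr1 (map_poly (intr : int -> algC)) (mulXsub1_Pk n).
by rewrite rmorphM !rmorphD !rmorphN /= !rmorph1 map_polyXn map_polyX.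
Qed.

Lemma horner_Pk_salem (n : nat) (a : algC) :
  (a ^+ 4 - 1) * (map_poly intr (Pk n)).[a] =
  a ^+ (4 * n + 5) * salem_num _ a - salem_rev _ a.
Proof.
have := congr1 (fun p => (map_poly (intr : int -> algC) p).[a]) (mulX4sub1_Pk n).
rewrite /salem_num /salem_rev.
by rewrite rmorphM !rmorphB /= !map_polyXn rmorphM !rmorphB /= !rmorph1 !map_polyXn map_polyX !hornerE.
Qed.

(** * The Schur-Cohn kernel and the root outside the disk *)

(** Writing (aw)^N as ((aw)^N - 1) + 1 produces the geometric sum; what remains, A(a)A(w) -
    A*(a)A*(w), is divisible by aw - 1 as well. *)
Lemma salem_kernel (R : comPzRingType) (N : nat) (a w : R) :
  (a ^+ N * salem_num R a) * (w ^+ N * salem_num R w) - salem_rev R a * salem_rev R w =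
  (a * w - 1) * (\sum_(m < N) (salem_num R a * a ^+ m) * (salem_num R w * w ^+ m)
    + (1 + a * w + a ^+ 2 * w ^+ 2) *+ 2
    - ((1 + a + a ^+ 2) * (1 + w + w ^+ 2)) *+ 2).
Proof.
have -> : \sum_(m < N) (salem_num R a * a ^+ m) * (salem_num R w * w ^+ m) =
    salem_num R a * salem_num R w * \sum_(m < N) (a * w) ^+ m.
  by rewrite big_distrr /=; apply: eq_bigr => m _; rewrite exprMn mulrACA.
have /(canRL (subrK _)) := subrX1 (a * w) N.
set s := \sum_(m < N) (a * w) ^+ m => geom.
rewrite mulrACA -exprMn geom /salem_num /salem_rev; ring.
Qed.

Lemma mulr_conjC_eq0 (x : algC) : (x * x^* == 0) = (x == 0).
Proof. by rewrite mulf_eq0 conjC_eq0 orbb. Qed.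

(** The kernel vanishes at all pairs from a, b, hence so does its Hermitian form in (x, y). A
    nonzero vector killing the negative square then kills the others, and x + y = xa + yb = 0 forces
    a = b. *)
Lemma outer_root_unique (N : nat) (a b : algC) :
  a ^+ N * salem_num _ a = salem_rev _ a -> b ^+ N * salem_num _ b = salem_rev _ b ->
  1 < `|a| -> 1 < `|b| -> a = b.
Proof.
move=> ra rb a1 b1; pose Phi (z : algC) : algC := 1 + z + z ^+ 2.
pose T (u v : algC) := \sum_(m < N) (salem_num _ u * u ^+ m) * (salem_num _ v * v ^+ m)^*.
have kern u v : u ^+ N * salem_num _ u = salem_rev _ u ->
    v ^+ N * salem_num _ v = salem_rev _ v -> 1 < `|u| -> 1 < `|v| ->
    T u v = (Phi u * (Phi v)^*) *+ 2 - (1 + u * v^* + u ^+ 2 * v^* ^+ 2) *+ 2.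
  move=> ru rv u1 v1.
  have uv1 : u * v^* - 1 != 0.
    rewrite subr_eq0; apply: contraTneq (mulr_egt1 u1 v1) => uv.
    by rewrite -(norm_conjC v) -normrM uv normr1 ltxx.
  have conj_num : (salem_num _ v)^* = salem_num _ v^*.
    by rewrite /salem_num !rmorphB !rmorphXn rmorph1.
  have conj_rev : (salem_rev _ v)^* = salem_rev _ v^*.
    by rewrite /salem_rev !rmorphB !rmorphXn rmorph1.
  have := salem_kernel _ N u v^*.
  rewrite -conj_num -conj_rev -rmorphXn -rmorphM ru rv subrr => /esym/eqP.
  rewrite mulf_eq0 (negPf uv1) /= => /eqP kuv.
  have -> : T u v = \sum_(m < N) salem_num _ u * u ^+ m * ((salem_num _ v)^* * v^* ^+ m).
    by apply: eq_bigr => m _; rewrite rmorphM rmorphXn.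
  move: kuv; rewrite /Phi !rmorphD rmorph1 rmorphXn => kuv.
  by apply/eqP; rewrite -subr_eq0 -[X in _ == X]kuv; apply/eqP; ring.
(* If Phi u = 0, the nonnegative [T u u] would be -2(1 + |u|^2 + |u|^4). This makes [x] nonzero
   below. *)
have Phi_neq0 u : u ^+ N * salem_num _ u = salem_rev _ u -> 1 < `|u| -> Phi u != 0.
  move=> ru u1; apply/eqP => Pu.
  have Tge0 : 0 <= T u u by apply: sumr_ge0 => m _; rewrite -normCK exprn_ge0.
  move: Tge0; rewrite (kern u u) // Pu mul0r mul0rn sub0r oppr_ge0.
  rewrite -exprMn -normCK -exprM => le0.
  have : 0 < (1 + `|u| ^+ 2 + `|u| ^+ (2 * 2)) *+ 2.
    by rewrite pmulrn_lgt0 // !ltr_wpDr ?exprn_ge0.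
  by move/lt_le_trans/(_ le0); rewrite ltxx.
(* The coefficients [x], [y] annihilate the only negative square. *)
pose x := Phi b; pose y := - Phi a.
have Pxy : x * Phi a + y * Phi b = 0 by rewrite /x /y; ring.
have Paa := kern a a ra ra a1 a1; have Pab := kern a b ra rb a1 b1.
have Pba := kern b a rb ra b1 a1; have Pbb := kern b b rb rb b1 b1.
pose E := \sum_(m < N) (x * (salem_num _ a * a ^+ m) + y * (salem_num _ b * b ^+ m)) *
  (x * (salem_num _ a * a ^+ m) + y * (salem_num _ b * b ^+ m))^*.
have E_ge0 : 0 <= E by apply: sumr_ge0 => m _; rewrite mul_conjC_ge0.
have EE : E = x * x^* * T a a + x * y^* * T a b + y * x^* * T b a + y * y^* * T b b.
  rewrite /E /T !big_distrr -!big_split /=; apply: eq_bigr => m _.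
  move: (salem_num _ a * a ^+ m) (salem_num _ b * b ^+ m) => u v.
  by rewrite rmorphD !rmorphM /=; ring.
have sq0 : E + ((x + y) * (x + y)^* + (x * a + y * b) * (x * a + y * b)^*
    + (x * a ^+ 2 + y * b ^+ 2) * (x * a ^+ 2 + y * b ^+ 2)^*) *+ 2 = 0.
  rewrite EE Paa Pab Pba Pbb.
  have -> : 0 = ((x * Phi a + y * Phi b) * (x * Phi a + y * Phi b)^*) *+ 2 :> algC.
    by rewrite Pxy mul0r mul0rn.
  rewrite !(rmorphD, rmorphM, rmorphXn) /=; ring.
have ge0 (z : algC) : 0 <= z * z^* by rewrite mul_conjC_ge0.
move: sq0 => /eqP; rewrite paddr_eq0 ?mulrn_wge0 ?addr_ge0 // => /andP[_].
rewrite mulrn_eq0 /= !paddr_eq0 ?addr_ge0 // !mulr_conjC_eq0 -andbA => /and3P[/eqP xy0 /eqP xayb0 _].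
have : x * (a - b) = 0.
  have -> : x * (a - b) = x * a + y * b - (x + y) * b by ring.
  by rewrite xayb0 xy0 mul0r subr0.
by move/eqP; rewrite mulf_eq0 (negPf (Phi_neq0 b rb b1)) subr_eq0 => /eqP.
Qed.

(** * Norms as determinants *)

Lemma det_sub_scalar (F : comNzRingType) (n : nat) (A : 'M[F]_n) (c : F) :
  \det (A - c%:M) = (-1) ^+ n * (char_poly A).[c].
Proof.
have -> : A - c%:M = - (c%:M - A) by rewrite opprB.
rewrite -scaleN1r detZ; congr (_ * _).
rewrite /char_poly -/(horner_eval c _) -det_map_mx; congr (\det _).
apply/matrixP => i j; rewrite !mxE /= /horner_eval hornerD hornerN hornerC hornerMn hornerX //.
Qed.

(** G splits into linear factors, and each X - g contributes det(A - g), the characteristic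
    polynomial at g up to sign. *)
Lemma det_horner_mx (F : closedFieldType) (n : nat) (A : 'M[F]_n.+1)
    (rs : seq F) (G : {poly F}) :
  char_poly A = \prod_(z <- rs) ('X - z%:P) ->
  \det (horner_mx A G) = \prod_(z <- rs) G.[z].
Proof.
move=> chA.
have szr : size rs = n.+1.
  by apply: succn_inj; rewrite -(size_prod_XsubC _ id) -chA size_char_poly.
have [gs ->] := closed_field_poly_normal G; set c := lead_coef G.
rewrite linearZ /= detZ rmorph_prod /=.
have -> : \det (\prod_(g <- gs) horner_mx A ('X - g%:P))
    = \prod_(g <- gs) \det (A - g%:M).
  elim: gs => [|g gs IH]; first by rewrite !big_nil det1.
  by rewrite !big_cons -mulmxE det_mulmx IH rmorphB /= horner_mx_X horner_mx_C.
under [RHS]eq_bigr => z _ do rewrite hornerZ horner_prod.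
rewrite big_split /= big_const_seq count_predT szr -Monoid.iteropE /=.
rewrite exchange_big /=; congr (_ * _).
apply: eq_bigr => g _; rewrite det_sub_scalar chA horner_prod -szr.
elim: (rs) => [|z s IH]; first by rewrite !big_nil mulr1.
by rewrite !big_cons /= exprS mulrACA IH !hornerE mulN1r opprB.
Qed.

(** The product is det G(C), with C the rational companion matrix of f. *)
Lemma prod_roots_Crat (f G : {poly rat}) (rs : seq algC) :
  f \is monic -> map_poly ratr f = \prod_(z <- rs) ('X - z%:P) ->
  \prod_(z <- rs) (map_poly ratr G).[z] \in Crat.
Proof.
move=> fmon frs.
case: rs frs => [|z0 rs] frs; first by rewrite big_nil rpred1.
have := companionmxK fmon; set C := companionmx f.
have szf : (size f).-1 = (size rs).+1.
  by rewrite -(size_map_poly (ratr : {rmorphism rat -> algC})) frs size_prod_XsubC.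
move: C; rewrite szf => C chC.
rewrite -(det_horner_mx _ _ (map_mx ratr C)).
  by rewrite -map_horner_mx det_map_mx Crat_rat.
by rewrite -map_char_poly /= chC.
Qed.

(** Serves for the moduli of the roots z and of the G(z); integrality of the product supplies the
    lower bound 1. *)
Lemma prod_le1_eq1 (R : numDomainType) (T : eqType) (F : T -> R) (s : seq T) :
  {in s, forall x, 0 <= F x <= 1} -> 1 <= \prod_(x <- s) F x ->
  {in s, forall x, F x = 1}.
Proof.
elim: s => [|x s IH] //= H; rewrite big_cons => ge1.
have /andP[x0 x1] := H x (mem_head _ _).
have Hs : {in s, forall y, 0 <= F y <= 1} by move=> y ys; rewrite H ?inE ?ys ?orbT.
have [p0 p1] : 0 <= \prod_(y <- s) F y /\ \prod_(y <- s) F y <= 1.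
  by rewrite big_seq; split; [apply: prodr_ge0 => y /Hs/andP[] | apply: prodr_ile1 => y /Hs].
have Fx1 : F x = 1.
  by apply: le_anti; rewrite x1 /=; apply: le_trans ge1 _; rewrite ler_piMr.
move: ge1; rewrite Fx1 mul1r => ge1 y; rewrite inE => /predU1P[-> //|].
exact: IH.
Qed.

(** * Degree and complex roots of P *)

Lemma Pk_monic_size n : Pk n \is monic /\ size (Pk n) = (4 * n + 5)%N.
Proof.
pose d := (4 * n + 4)%N.
have low : (size (Pk n - 'X^d)%R <= d)%N.
  rewrite /d /Pk; elim: n {d} => [|n IH].
    rewrite big_ord_recr big_ord0 /=.
    have -> : 1 + (0 + 'X^(4 * 0) * ('X^4 - 'X^3 - 'X^2 - 'X)) - 'X^(4 * 0 + 4) =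
        Poly [:: 1; -1; -1; -1] :> {poly int}.
      by rewrite /= !cons_poly_def !muln0 !add0n mul0r; ring.
    exact: size_Poly.
  rewrite big_ord_recr /= addrA.
  set p := 1 + _ in IH *.
  (* The old leading term X^(4n+4) joins the new block, leaving a cubic factor. *)
  have -> : p + 'X^(4 * n.+1) * ('X^4 - 'X^3 - 'X^2 - 'X) - 'X^(4 * n.+1 + 4) =
     (p - 'X^(4 * n + 4)) + 'X^(4 * n.+1) * Poly [:: 1; -1; -1; -1] :> {poly int}.
    by rewrite /= !cons_poly_def mulnS !exprD mul0r; ring.
  apply: leq_trans (size_polyD _ _) _; rewrite geq_max; apply/andP; split.
    by apply: leq_trans IH _; lia.
  rewrite mulrC; apply: leq_trans (size_polyMleq _ _) _.
  rewrite size_polyXn addnS /= [leqRHS]addnC leq_add2r.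
  exact: (size_Poly [:: 1; -1; -1; -1 : int]).
have PE : Pk n = 'X^d + (Pk n - 'X^d) by rewrite addrC subrK.
have lt : (size (Pk n - 'X^d)%R < size ('X^d : {poly int})%R)%N by rewrite size_polyXn ltnS.
split.
  by rewrite monicE PE lead_coefDl // lead_coefXn.
by rewrite PE size_polyDl // size_polyXn /d -addnS.
Qed.

Section Roots.
Variable n : nat.
Local Notation N := (4 * n + 5)%N.
Local Notation PC := (map_poly intr (Pk n) : {poly algC}).
Local Notation GC := (map_poly intr (Pk_half n) : {poly algC}).

Lemma Pk_root_expN a : root PC a -> a ^+ N = 1 + GC.[a] *+ 2.
Proof.
move/rootP=> pa; have := congr1 (horner^~ a) (map_mulXsub1_Pk n).
rewrite /= !(hornerD, hornerN, hornerM, hornerMn, hornerC, hornerX, hornerXn) pa mulr0.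
by move/eqP; rewrite eq_sym addrAC subr_eq0 => /eqP ->.
Qed.

Lemma Pk_root_salem a : root PC a -> a ^+ N * salem_num _ a = salem_rev _ a.
Proof.
by move/rootP=> pa; have := horner_Pk_salem n a; rewrite pa mulr0 => /esym/subr0_eq.
Qed.

Lemma Pk_root_neq0 a : root PC a -> a != 0.
Proof.
move/Pk_root_salem => ra; apply: contra_eq_neq ra => ->.
by rewrite addnS expr0n mul0r /salem_rev !expr0n /= !subr0 eq_sym oner_eq0.
Qed.

(** Covers the fourth roots of unity, where [horner_Pk_salem] only says 0 = 0. *)
Lemma horner_Pk (a : algC) : a ^+ 4 = 1 ->
  PC.[a] = 1 + (1 - a ^+ 3 - a ^+ 2 - a) *+ n.+1.
Proof.
move=> a4; rewrite /Pk rmorphD rmorph_sum rmorph1 /= hornerD hornerC horner_sum.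
congr (_ + _); rewrite (eq_bigr (fun=> 1 - a ^+ 3 - a ^+ 2 - a)).
  by rewrite sumr_const card_ord.
move=> l _; rewrite rmorphM !rmorphB /= !map_polyXn map_polyX !hornerE.
by rewrite exprM a4 expr1n mul1r.
Qed.

Lemma Pk_root_neq1 a : root PC a -> a != 1.
Proof.
move=> pa; apply: contraTneq pa => ->; rewrite rootE horner_Pk ?expr1n //.
have -> : 1 - 1 - 1 - 1 = - 2%:R :> algC by ring.
by rewrite mulNrn -mulrnA subr_eq0 -[X in X == _]mulr1n eqr_nat; lia.
Qed.

Lemma Pk_root_neqN1 a : root PC a -> a != -1.
Proof.
move=> pa; apply: contraTneq pa => ->; rewrite rootE horner_Pk; last by ring.
have -> : 1 - (-1) ^+ 3 - (-1) ^+ 2 - -1 = 2%:R :> algC by ring.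
by rewrite -mulrnA -[X in X + _]mulr1n -mulrnDr pnatr_eq0.
Qed.

Lemma Pk_root_Aint a : root PC a -> a \in Aint.
Proof.
move=> pa; apply: (root_monic_Aint pa).
  by rewrite monic_map //; case: (Pk_monic_size n).
by apply/polyOverP=> i; rewrite coef_map /= intr_int.
Qed.

Lemma Aint_horner_int (p : {poly int}) (a : algC) :
  a \in Aint -> (map_poly intr p).[a] \in Aint.
Proof.
move=> aA; rewrite horner_poly; apply: rpred_sum => i _.
by rewrite rpredM ?rpredX // Aint_int.
Qed.

(* A double root [a] would give [N * a ^+ N = 2 * _] with [a ^+ N = 1 + 2 * _],
   so the rational [N / 2] would be an algebraic integer. *)
Lemma Pk_root_simple a : root PC a -> PC^`().[a] != 0.
Proof.
move=> pa; apply/eqP => p'a; have aA := Pk_root_Aint a pa.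
have := congr1 (fun p : {poly algC} => p^`().[a]) (map_mulXsub1_Pk n).
rewrite derivM [(_ + _ *+ _)^`()]derivD derivMn !derivB derivX derivXn -[1]polyC1 derivC.
rewrite !(hornerD, hornerN, hornerM, hornerMn, hornerC, hornerX, hornerXn) p'a (rootP pa).
rewrite !mulr0 add0r sub0r => /esym/eqP; rewrite addrC subr_eq0 => /eqP.
have N1 : N.-1.+1 = N by lia.
move/(congr1 ( *%R a)); rewrite !mulrnAr -exprS N1 (Pk_root_expN a pa) => NE.
pose z := a * GC^`().[a] - GC.[a] *+ N.
have zA : z \in Aint.
  by rewrite /z rpredB ?rpredM ?rpredMn ?deriv_map ?Aint_horner_int.
have z2 : z *+ 2 = N%:R.
  by rewrite /z mulrnBl NE mulrnDl -!mulrnA [(N * 2)%N]mulnC addrK.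
have zQ : z \in Crat.
  have -> : z = N%:R / 2%:R by rewrite -z2 -mulr_natr mulfK ?pnatr_eq0.
  by rewrite rpred_div ?rpred_nat.
have /intrP[m zm] := Cint_rat_Aint zQ zA.
have : (m *+ 2)%:~R = (N%:Z)%:~R :> algC by rewrite rmorphMn /= -zm z2.
by move/intr_inj; lia.
Qed.
End Roots.

(** * Rational factors of P *)

Section Factors.
Variable n : nat.
Local Notation N := (4 * n + 5)%N.
Local Notation PC := (map_poly intr (Pk n) : {poly algC}).
Local Notation PQ := (map_poly intr (Pk n) : {poly rat}).
Local Notation toC := (map_poly (ratr : rat -> algC)).

Lemma map_ratr_intr (p : {poly int}) :
  toC (map_poly intr p) = map_poly intr p.
Proof. by rewrite -map_poly_comp; apply: eq_map_poly => z /=; rewrite ratr_int. Qed.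

(** If z^N = 1 then A(z) = A*(z), and A - A* = 2(X^3 - 1); if z^N = -1, use A + A* = -2X(X + 1),
    whose roots are not roots of P. *)
Lemma Pk_root_of_unity_cubic (z : algC) : root PC z ->
  z ^+ N = 1 \/ z ^+ N = -1 -> z ^+ 2 + z + 1 = 0.
Proof.
move=> pz uz; have := Pk_root_salem n z pz.
have z0 := Pk_root_neq0 n z pz; have z1 := Pk_root_neq1 n z pz.
have zN1 := Pk_root_neqN1 n z pz.
case: uz => ->.
  move=> E; have : (z - 1) * (z ^+ 2 + z + 1) *+ 2 = 0.
    by rewrite -(subrr (salem_rev _ z)) -{1}E /salem_num /salem_rev; ring.
  by move/eqP; rewrite mulrn_eq0 mulf_eq0 subr_eq0 (negPf z1) /= => /eqP.
move=> E; have : z * (z - -1) *+ 2 = 0.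
  by rewrite -(subrr (salem_rev _ z)) -{1}E /salem_num /salem_rev; ring.
move/eqP; rewrite mulrn_eq0 mulf_eq0 (negPf z0) subr_eq0 /= => /eqP zN.
by rewrite zN eqxx in zN1.
Qed.

(** Parallelogram law: |u + 1|^2 + |u - 1|^2 = 2(|u|^2 + 1) = 4. *)
Lemma eqN1_norm_sub1 (u : algC) : `|u| = 1 -> `|u - 1| = 2%:R -> u = -1.
Proof.
move=> u1 u2; apply/eqP; rewrite -subr_eq0 opprK -normr_eq0 -sqrf_eq0.
have := congr1 (fun x => x ^+ 2) u2; have := congr1 (fun x => x ^+ 2) u1.
rewrite !normCK rmorphB rmorphD rmorph1 /= => uu uu2.
apply/eqP.
have -> : (u + 1) * (u^* + 1) = (u * u^* + 1) *+ 2 - (u - 1) * (u^* - 1) by ring.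
by rewrite uu uu2; ring.
Qed.

Lemma monic_factor_root (f : {poly rat}) :
    f \is monic -> f %| PQ -> size f != 1 ->
  exists2 z, root (toC f) z & 1 < `|z| \/ z ^+ 2 + z + 1 = 0.
Proof.
move=> fmon fP sf.
have [rs frs] := closed_field_poly_normal (toC f).
move: frs; rewrite lead_coef_map (monicP fmon) rmorph1 scale1r => frs.
have rootf z : z \in rs -> root (toC f) z by rewrite frs root_prod_XsubC.
have rootPC z : z \in rs -> root PC z.
  move=> /rootf fz; rewrite -map_ratr_intr.
  by move: fP; rewrite -(dvdp_map (ratr : {rmorphism rat -> algC})) => /dvdpP[q ->];
     rewrite rootM fz orbT.
have rs0 : rs != [::].
  apply: contraNneq sf => rs0.
  by rewrite -(size_map_poly (ratr : {rmorphism rat -> algC})) frs rs0 big_nil size_poly1.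
(* Rational as a norm, and an algebraic integer because the roots of P are. *)
have int_prod (G : {poly int}) :
    \prod_(z <- rs) (map_poly intr G : {poly algC}).[z] \is a Num.int.
  apply: Cint_rat_Aint.
    by rewrite -map_ratr_intr; apply: prod_roots_Crat fmon frs.
  rewrite big_seq; apply: rpred_prod => z /rootPC/Pk_root_Aint; exact: Aint_horner_int.
have [/hasP[z zrs z1]|/hasPn/= rs1] := boolP (has (fun z => 1 < `|z|) rs).
  by exists z; [exact: rootf | left].
have norm1 : {in rs, forall z, `|z| = 1}.
  apply: prod_le1_eq1 => [z zrs|].
    by rewrite normr_ge0 real_leNgt ?normr_real ?real1 // rs1.
  have := int_prod 'X; rewrite map_polyX.
  under eq_bigr => z _ do rewrite hornerX.
  rewrite -normr_prod => /norm_intr_ge1; apply.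
  by rewrite prodf_seq_neq0; apply/allP => z /rootPC/Pk_root_neq0.
pose beta z := (map_poly intr (Pk_half n) : {poly algC}).[z].
have betaE z : z \in rs -> z ^+ N - 1 = beta z *+ 2.
  by move=> /rootPC/Pk_root_expN->; rewrite addrC addKr.
have norm_pow z : z \in rs -> `|z ^+ N| = 1.
  by move=> zrs; rewrite normrX norm1 // expr1n.
have beta_le1 : {in rs, forall z, 0 <= `|beta z| <= 1}.
  move=> z zrs; rewrite normr_ge0 /= -(ler_pMn2r (n := 2)) // -normrMn -betaE //.
  by apply: le_trans (ler_normB _ _) _; rewrite norm_pow // normr1.
have [z zrs uz] : exists2 z, z \in rs & z ^+ N = 1 \/ z ^+ N = -1.
  have := int_prod (Pk_half n); rewrite -/beta.
  have [/eqP|nz] := eqVneq (\prod_(z <- rs) beta z) 0.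
    rewrite prodf_seq_eq0 => /hasP[z zrs /= /eqP bz] _; exists z => //; left.
    by apply/eqP; rewrite -subr_eq0 betaE // bz mul0rn.
  move=> /norm_intr_ge1/(_ nz); rewrite normr_prod => /(prod_le1_eq1 _ _ _ _ beta_le1) b1.
  case: (rs) rs0 b1 norm_pow betaE => // z s _ b1 norm_pow betaE.
  exists z; rewrite ?mem_head //; right; apply: eqN1_norm_sub1; first by rewrite norm_pow ?mem_head.
  by rewrite betaE ?mem_head // normrMn b1 ?mem_head.
exists z; first exact: rootf.
by right; apply: Pk_root_of_unity_cubic => //; apply: rootPC.
Qed.

Lemma factor_root (f : {poly rat}) : f %| PQ -> size f != 1 ->
  exists2 z, root (toC f) z & 1 < `|z| \/ z ^+ 2 + z + 1 = 0.
Proof.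
move=> fP sf.
have PQ0 : PQ != 0.
  by rewrite monic_neq0 // monic_map //; case: (Pk_monic_size n).
have f0 : lead_coef f != 0 by rewrite lead_coef_eq0; apply: contraNneq PQ0 => f0; rewrite f0 dvd0p in fP.
have c0 : (lead_coef f)^-1 != 0 by rewrite invr_eq0.
have [|||z rz Hz] := monic_factor_root ((lead_coef f)^-1 *: f).
- by rewrite monicE lead_coefZ mulVf.
- by rewrite dvdpZl.
- by rewrite size_scale.
exists z => //; move: rz; rewrite map_polyZ rootZ // fmorph_eq0 //.
Qed.

(** A common root kills every term of the product rule, so P would have a double root. *)
Lemma no_common_root (f g : {poly rat}) (z : algC) : f * g %| PQ ->
  root (toC f) z -> ~~ root (toC g) z.
Proof.
move=> /dvdpP[h PE] fz; apply/negP => gz.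
have PCE : PC = toC h * (toC f * toC g) by rewrite -map_ratr_intr PE !rmorphM.
have := Pk_root_simple n z; rewrite PCE !derivM !(hornerD, hornerM).
by rewrite !rootM fz gz orbT (rootP fz) (rootP gz) !(mulr0, mul0r, addr0) !orbT eqxx => /(_ isT).
Qed.

(** [D] absorbs the primitive cube roots of unity among the roots of P; it will be 1 or X^2 + X +
    1. *)
Lemma irreducible_cofactor (R D : {poly rat}) : R * D = PQ -> (1 < size R)%N ->
  (forall z, root PC z -> z ^+ 2 + z + 1 = 0 -> root (toC D) z) ->
  irreducible_poly R.
Proof.
move=> RD sR cubD; split=> // f sf /dvdpP[g Rgf].
have fgP : f * g * D = PQ by rewrite -RD Rgf [f * g]mulrC.
have [/size_poly1P[c c0 gc]|sg] := boolP (size g == 1%N).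
  by rewrite Rgf gc mul_polyC eqp_sym eqp_scale.
(* A primitive cube root of unity in [h] would be shared with [D], so the root from [factor_root]
   lies outside the disk. *)
suff outer h h' : h * h' * D = PQ -> size h != 1 ->
    exists2 z, root PC z /\ root (toC h) z & 1 < `|z|.
  have [a [pa fa] a1] := outer f g fgP sf.
  have [b [pb gb] b1] := outer g f (etrans (congr1 (fun x => x * D) (mulrC g f)) fgP) sg.
  have ab : a = b := outer_root_unique _ _ _ (Pk_root_salem n a pa) (Pk_root_salem n b pb) a1 b1.
  have fgd : f * g %| PQ by rewrite -fgP dvdp_mulr.
  by have := no_common_root f g a fgd fa; rewrite ab gb.
move=> hP sh; have hd : h %| PQ by rewrite -hP -mulrA dvdp_mulr.
have [z hz Hz] := factor_root h hd sh.
have pz : root PC z.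
  by rewrite -map_ratr_intr -hP !rmorphM /= !rootM hz.
exists z => //; case: Hz => // /(cubD z pz) Dz.
have hD : h * D %| PQ by rewrite -hP mulrAC dvdp_mulr.
by have := no_common_root h D z hD hz; rewrite Dz.
Qed.
End Factors.

(** * The factor X^2 + X + 1 and the conclusion *)

(** At such a z both A and A* equal 1, so z^N = 1 and 3 divides N = 4n + 5. *)
Lemma Pk_cubic_root (n : nat) (z : algC) :
  root (map_poly intr (Pk n)) z -> z ^+ 2 + z + 1 = 0 -> (n %% 3 = 1)%N.
Proof.
move=> pz z2; have := Pk_root_salem n z pz.
have z3 : z ^+ 3 = 1.
  apply/eqP; rewrite -subr_eq0.
  have -> : z ^+ 3 - 1 = (z - 1) * (z ^+ 2 + z + 1) by ring.
  by rewrite z2 mulr0.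
have -> : salem_num _ z = z ^+ 3 - (z ^+ 2 + z + 1) by rewrite /salem_num; ring.
have -> : salem_rev _ z = 1 - z ^+ 3 + 1 - (z ^+ 2 + z + 1) by rewrite /salem_rev; ring.
rewrite z2 z3 !subr0 subrr add0r mulr1 => zN.
have z1 := Pk_root_neq1 n z pz.
have zE m r : (4 * n + 5)%N = (3 * m + r)%N -> z ^+ r = 1.
  by move=> Nmr; rewrite -zN Nmr exprD exprM z3 expr1n mul1r.
have := ltn_pmod n (isT : 0 < 3)%N.
case rn: (n %% 3)%N => [|[|[|]]] // _.
  have zz : z ^+ 2 = 1 by apply: (zE (4 * (n %/ 3) + 1)%N); lia.
  by move: z1; rewrite -[z]mul1r -{1}zz -exprSr z3 eqxx.
have zz : z ^+ 1 = 1 by apply: (zE (4 * (n %/ 3) + 4)%N); lia.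
by move: z1; rewrite -[z]expr1 zz eqxx.
Qed.

Lemma Pk_cubic_factor (j : nat) :
  exists R : {poly int}, Pk (3 * j + 1) = R * ('X^2 + 'X + 1).
Proof.
elim: j => [|j [R IH]].
  exists ('X^6 - 'X^5 *+ 2 + 'X^3 - 'X *+ 2 + 1).
  by rewrite /Pk !big_ord_recr big_ord0 /=; ring.
(* Three consecutive terms carry the factor 1 + X^4 + X^8 = (X^2 + X + 1)(X^2 - X + 1)(X^4 - X^2 +
   1). *)
exists (R + 'X^(4 * (3 * j + 2)) * ('X^4 - 'X^3 - 'X^2 - 'X) *
  (('X^2 - 'X + 1) * ('X^4 - 'X^2 + 1))).
rewrite mulrDl -IH (_ : (3 * j.+1 + 1 = (3 * j + 1).+3)%N); last by lia.
rewrite /Pk 3!big_ord_recr /= !addrA -!addrA; congr (_ + (_ + _)).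
rewrite (_ : (3 * j + 1).+1 = 3 * j + 2)%N; last by lia.
rewrite !mulnS !exprD; ring.
Qed.

(* R_{k-1} is an integer polynomial (for k = 2 mod 3, P_{k-1} = R_{k-1} (q^2+q+1)
   exactly in Z[q]) and it is irreducible over Q. *)
Theorem mainTheorem3 (k : nat) (hk : (1 <= k)%N) :
  exists R : {poly int},
    (if (k %% 3 == 2)%N then Pk k.-1 = R * ('X^2 + 'X + 1) else R = Pk k.-1) /\
    irreducible_poly (map_poly (fun z : int => z%:~R) R : {poly rat}).
Proof.
case: k hk => // n _ /=.
have [_ Psize] := Pk_monic_size n.
have sizeQ : size (map_poly intr (Pk n) : {poly rat}) = (4 * n + 5)%N.
  by rewrite size_map_inj_poly // => x y /intr_inj.
case: (eqVneq (n.+1 %% 3) 2)%N => n3; last first.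
  (* Here no root of P is a primitive cube root of unity, so the cofactor 1 suffices. *)
  exists (Pk n); split=> //; apply: (irreducible_cofactor n _ 1); rewrite ?mulr1 //.
    by rewrite sizeQ; lia.
  by move=> z pz /(Pk_cubic_root n z pz); lia.
have [R RE] := Pk_cubic_factor (n %/ 3).
have {RE} RE : Pk n = R * ('X^2 + 'X + 1) by rewrite -RE; congr Pk; lia.
exists R; split=> //.
pose D : {poly rat} := 'X^2 + 'X + 1.
have RD : map_poly intr R * D = map_poly intr (Pk n).
  by rewrite RE rmorphM !rmorphD /= map_polyXn map_polyX rmorph1.
have Dsize : (size D <= 3)%N.
  apply: leq_trans (size_polyD _ _) _; rewrite size_poly1 geq_max andbT.
  by apply: leq_trans (size_polyD _ _) _; rewrite size_polyXn size_polyX.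
have Rsize : (1 < size (map_poly intr R : {poly rat}))%N.
  have := size_polyMleq (map_poly intr R : {poly rat}) D; rewrite RD sizeQ; lia.
apply: (irreducible_cofactor n _ D) => //.
move=> z _ z2; rewrite rootE !rmorphD /= map_polyXn map_polyX rmorph1 !hornerE.
by rewrite z2.
Qed.
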